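(* Let $D:=\{d_1,\dots,d_{|D|}\}$ be a finite subset of $\mathbb{R}^n$ and $C=\mathrm{conv}(D)$. Let $z_k$, $k=1,2,\dots$, be a sequence of points from $C$, and write $z_k=Xa_k$ where $X=[d_1,\dots,d_{|D|}]$ is the matrix with columns $d_1,\dots,d_{|D|}$ and $a_k\in\Delta:=\{a\in\mathbb{R}^{|D|}:\sum_{i=1}^{|D|}a^{(i)}=1,\ a^{(i)}\ge 0\}$. Let $E=\{e_1,\dots,e_{|D|}\}\subset\Delta$ be the set of unit vectors, and for $k=0,1,2,\dots$ select successively $b_{k+1}\in E$ such that $$S_k+a_{k+1}-b_{k+1}\succeq-\underline{S}\mathbf{1},\qquad\text{where } S_k=\sum_{i=1}^k(a_i-b_i),\ S_0=0.$$ Provided $\underline{S}\ge 1$, such a $b_{k+1}$ always exists (at every step $k$, whatever the previous selections $b_1,\dots,b_k\in E$ satisfying $S_{j}+a_{j+1}-b_{j+1}\succeq-\underline{S}\mathbf{1}$ for all $0\le j\le k-1$). Further, the corresponding sequence $x_k=Xb_k$ of points from $D$ satisfies $$\Big\|\sum_{i=1}^k(z_i-x_i)\Big\|_\infty\le(|D|-1)\,\underline{S}\,\|X\|_\infty\qquad\text{for all }k=1,2,\dots$$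
   Context: $e_i$ is the unit vector with all elements zero apart from element $i$, equal to one; $\mathbf{1}$ is the all-ones vector; $\succeq$ is the elementwise inequality; $a^{(i)}$ is the $i$-th element of $a$. For a matrix, $\|\cdot\|_\infty$ is the operator norm induced by the vector $\infty$-norm (maximum absolute row sum). *)

(* Defs.v *)
From HB Require Import structures.
From mathcomp Require Import all_boot all_order all_algebra finmap.
From mathcomp Require Import all_classical all_reals all_analysis.

Set Implicit Arguments.
Unset Strict Implicit.
Unset Printing Implicit Defensive.

Import Order.TTheory GRing.Theory Num.Theory.
Import numFieldNormedType.Exports.

Local Open Scope classical_set_scope.
Local Open Scope ring_scope.

Definition conv_hull (R : numDomainType) (M : lmodType R) (A : set M) : set M :=
  smallest (@convex_set R M) A.

(* The norm of the library on 'cV[R]_m is the infinity-norm. *)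
Definition opnorm_inf (R : realType) (m n : nat) (A : 'M[R]_(m, n)) : R :=
  sup [set `|A *m v| | v in [set v : 'cV[R]_n | `|v| <= 1]].

Definition cV_le (R : numDomainType) (m : nat) (u v : 'cV[R]_m) : Prop :=
  forall i, u i 0 <= v i 0.

Definition simplex (R : numDomainType) (m : nat) : set 'cV[R]_m :=
  [set a : 'cV[R]_m | \sum_i a i 0 = 1 /\ cV_le 0 a].

Definition unit_vectors (R : numDomainType) (m : nat) : set 'cV[R]_m :=
  range (fun i : 'I_m => delta_mx i 0).

Definition mx_of_cols (R : Type) (m n : nat) (d : 'I_m -> 'cV[R]_n) :
  'M[R]_(n, m) := \matrix_(i, j) d j i 0.

Section selection.
Context (R : numDomainType) (m : nat).
Implicit Types (s : R) (a b : nat -> 'cV[R]_m).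

(* Sequences are indexed from 1; their value at 0 is never used. *)
Definition discrepancy a b (k : nat) : 'cV[R]_m :=
  \sum_(1 <= i < k.+1) (a i - b i).

(* [e] may be selected as the vector of index [k.+1]. *)
Definition admissible s a b (k : nat) (e : 'cV[R]_m) : Prop :=
  @unit_vectors R m e /\
  cV_le (- s *: const_mx 1) (discrepancy a b k + a k.+1 - e).

End selection.

Section facts.
Context (R : realType).

Lemma cV_normP (m : nat) (v : 'cV[R]_m) (c : R) : 0 <= c ->
  reflect (forall i, `|v i 0| <= c) (`|v| <= c).
Proof.
move=> c0; rewrite [X in X <= c]/Num.norm /= mx_normrE.
apply: (iffP (bigmax_leP _ _ _ _)) => [[_ h] i|h]; first exact: (h (i, 0)).
by split=> // -[i j] _ /=; rewrite (ord1 j).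
Qed.

Lemma opnorm_infE (m n : nat) (A : 'M[R]_(m, n)) :
  opnorm_inf A = \big[Order.max/0]_i \sum_j `|A i j|.
Proof.
set M : R := \big[_/_]_i _.
have M0 : 0 <= M by exact: bigmax_ge_id.
have ubM : ubound [set `|A *m v| | v in [set v : 'cV[R]_n | `|v| <= 1]] M.
  move=> _ [v /= v1 <-]; apply/cV_normP => // i.
  apply: (@le_trans _ _ (\sum_j `|A i j|)); last first.
    exact: (@le_bigmax _ _ _ 0 (fun i => \sum_j `|A i j|)).
  rewrite mxE; apply: (le_trans (ler_norm_sum _ _ _)); apply: ler_sum => j _.
  by rewrite normrM ler_piMr//; move/(cV_normP _ ler01): v1; apply.
have ne : [set `|A *m v| | v in [set v : 'cV[R]_n | `|v| <= 1]] !=set0.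
  by exists `|A *m (0 : 'cV[R]_n)|; exists 0 => //=; rewrite normr0 ler01.
apply/eqP; rewrite eq_le; apply/andP; split; first exact: ge_sup.
have hs : has_sup [set `|A *m v| | v in [set v : 'cV[R]_n | `|v| <= 1]].
  by split=> //; exists M.
apply/bigmax_leP; split => [|i _].
  apply: (@le_trans _ _ `|A *m (0 : 'cV[R]_n)|) => //.
  by apply: ub_le_sup; [exists M|exists 0 => //=; rewrite normr0].
pose v : 'cV[R]_n := \col_j Num.sg (A i j).
have v1 : `|v| <= 1.
  by apply/cV_normP => // j; rewrite mxE normr_sg; case: (_ != _).
apply: (@le_trans _ _ `|A *m v|); last first.
  by apply: ub_le_sup; [exists M|exists v].
have /(cV_normP _ (normr_ge0 _))/(_ i) : `|A *m v| <= `|A *m v| by [].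
apply: le_trans; rewrite mxE; apply: le_trans (ler_norm _).
by apply: ler_sum => j _; rewrite mxE mulrC -normrEsg.
Qed.

Lemma convex_set_sum (M : lmodType R) (C : set M) (m : nat)
    (w : 'I_m -> R) (p : 'I_m -> M) :
  @convex_set R M C -> (forall i, 0 <= w i) -> \sum_i w i = 1 ->
  (forall i, C (p i)) -> C (\sum_i w i *: p i).
Proof.
move=> cC; elim: m w p => [|m IH] w p w0.
  by rewrite big_ord0 => /esym/eqP; rewrite oner_eq0.
rewrite !big_ord_recr /=; set W := \sum_(i < m) _ => w1 Cp.
have W0 : 0 <= W by exact: sumr_ge0.
have [WE|Wneq0] := eqVneq W 0.
  rewrite big1 ?add0r => [|i _].
    by move: w1; rewrite WE add0r => ->; rewrite scale1r.
  move/eqP: WE; rewrite psumr_eq0// => /allP/(_ i).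
  by rewrite mem_index_enum => /(_ isT)/eqP ->; rewrite scale0r.
have W1 : W <= 1 by rewrite -w1 lerDl.
have cp : C (\sum_(i < m) (W^-1 * w (widen_ord (leqnSn m) i)) *:
               p (widen_ord (leqnSn m) i)).
  apply: IH => // [i|]; first by rewrite mulr_ge0 // invr_ge0.
  by rewrite -mulr_sumr mulVf.
have := cC _ _ (Itv01 W0 W1) (mem_set cp) (mem_set (Cp ord_max)).
move/set_mem; congr C; rewrite /conv /=; congr (_ + _).
  by rewrite scaler_sumr; apply: eq_bigr => i _; rewrite scalerA mulrA mulfV // mul1r.
by congr (_ *: _); rewrite -[RHS](addKr W) w1 addrC.
Qed.

Lemma mx_of_colsM (m n : nat) (d : 'I_m -> 'cV[R]_n) (a : 'cV[R]_m) :
  mx_of_cols d *m a = \sum_j a j 0 *: d j.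
Proof.
apply/colP => i; rewrite mxE summxE.
by apply: eq_bigr => j _; rewrite !mxE mulrC.
Qed.

Lemma conv_hull_finP (m n : nat) (d : 'I_m -> 'cV[R]_n) (z : 'cV[R]_n) :
  conv_hull (range d) z <->
  exists2 a, simplex a & z = mx_of_cols d *m a.
Proof.
split=> [|[a [a1 a0] ->]].
  pose C : set 'cV[R]_n := [set z | exists2 a, simplex a & z = mx_of_cols d *m a].
  suff : conv_hull (range d) `<=` C by apply.
  apply: smallest_sub => [x y l|_ [j _ <-]].
    move=> /set_mem[a [a1 a0] ->] /set_mem[b [b1 b0] ->]; apply/mem_set.
    exists (l%:num *: a + (1 - l%:num) *: b); last first.
      by rewrite mulmxDr -!scalemxAr.
    split=> [|i].
      under eq_bigr do rewrite !mxE.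
      by rewrite big_split /= -!mulr_sumr a1 b1 !mulr1 addrC subrK.
    have := a0 i; have := b0 i; rewrite !mxE => bi ai.
    by rewrite addr_ge0// mulr_ge0// subr_ge0.
  exists (delta_mx j 0); last first.
    rewrite mx_of_colsM (bigD1 j)//= big1 => [|i ij].
      by rewrite mxE !eqxx scale1r addr0.
    by rewrite mxE (negPf ij) scale0r.
  split=> [|i]; last by rewrite !mxE ler0n.
  rewrite (bigD1 j)//= big1 => [|i ij]; last by rewrite mxE (negPf ij).
  by rewrite mxE !eqxx addr0.
move=> C [cC dC]; rewrite mx_of_colsM; apply: convex_set_sum => //.
  by move=> i; have := a0 i; rewrite mxE.
by move=> i; apply: dC; exists i.
Qed.

End facts.

(* Main.v *)
(* Every discrepancy vector S_k has coordinate sum 0, since both a_i and b_i sum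
   to 1.  Hence S_k + a_(k+1) sums to 1 and has a positive coordinate; that
   coordinate may be lowered by 1 without going below -s when 1 <= s, while the
   other ones only grew from S_k.  Conversely, entries bounded below by -s and
   summing to 0 are at most (|D| - 1) s in absolute value, and
   \sum_i (z_i - x_i) = X S_k. *)

Require Import Defs.
From HB Require Import structures.
From mathcomp Require Import all_boot all_order all_algebra finmap.
From mathcomp Require Import all_classical all_reals all_analysis.

Set Implicit Arguments.
Unset Strict Implicit.
Unset Printing Implicit Defensive.

Import Order.TTheory GRing.Theory Num.Theory.
Import numFieldNormedType.Exports.

Local Open Scope classical_set_scope.
Local Open Scope ring_scope.

Section lemmas.
Context (R : realType).

Lemma opnorm_inf_ge0 (m n : nat) (A : 'M[R]_(m, n)) : 0 <= opnorm_inf A.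
Proof. by rewrite opnorm_infE bigmax_ge_id. Qed.

(** By the triangle inequality in each row: every [|v j 0|] is at most the norm of [v], and
    [opnorm_infE] bounds the absolute row sum. *)
Lemma norm_mulmx_le (m n : nat) (A : 'M[R]_(m, n)) (v : 'cV[R]_n) :
  `|A *m v| <= opnorm_inf A * `|v|.
Proof.
apply/cV_normP => [|i]; first by rewrite mulr_ge0 ?opnorm_inf_ge0.
rewrite mxE; apply: (le_trans (ler_norm_sum _ _ _)).
apply: (@le_trans _ _ ((\sum_j `|A i j|) * `|v|)).
  rewrite mulr_suml; apply: ler_sum => j _; rewrite normrM ler_wpM2l//.
  exact: (cV_normP _ (normr_ge0 v) (lexx _)).
rewrite ler_wpM2r// opnorm_infE.
exact: (@le_bigmax _ _ _ 0 (fun i => \sum_j `|A i j|)).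
Qed.

Lemma sum_delta_mx (m : nat) (i : 'I_m) :
  \sum_j (delta_mx i 0 : 'cV[R]_m) j 0 = 1.
Proof.
rewrite (bigD1 i)//= big1 => [|j ij]; last by rewrite mxE (negPf ij).
by rewrite mxE !eqxx addr0.
Qed.

(** Each entry is minus the sum of the [m - 1] others, whence the upper bound; the lower bound is
    the hypothesis itself, up to the case of a single entry. *)
Lemma norm_sum0_le (m : nat) (v : 'cV[R]_m) (s : R) : (0 < m)%N ->
  \sum_i v i 0 = 0 -> (forall i, - s <= v i 0) -> `|v| <= (m%:R - 1) * s.
Proof.
case: m v => // m v _ v0 vs; rewrite -natr1 addrK.
(* The sign of [s] is forced: [m.+1] entries, each at least [- s], sum to 0. *)
have s0 : 0 <= s.
  have : \sum_(i < m.+1) - s <= 0 by rewrite -[leRHS]v0; apply: ler_sum => i _.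
  by rewrite sumr_const card_ord mulNrn oppr_le0 pmulrn_lge0.
apply/cV_normP => [|i]; first by rewrite mulr_ge0.
have vi : v i 0 = - \sum_(j < m.+1 | j != i) v j 0.
  by move: v0; rewrite (bigD1 i)//= => /eqP; rewrite addr_eq0 => /eqP.
have le_vi : v i 0 <= m%:R * s.
  rewrite vi lerNl; apply: (@le_trans _ _ (\sum_(j < m.+1 | j != i) - s)).
    by rewrite sumr_const cardC1 card_ord mulNrn mulr_natl.
  by apply: ler_sum => j _.
(* For the lower bound, [- s] suffices only if the factor of [s] is at least 1. With a single entry
   the factor is 0, but then the entry is an empty sum. *)
rewrite ler_norml le_vi andbT; case: m v v0 vs i vi le_vi => [|m] v v0 vs i vi _.
  by rewrite vi big1 ?mul0r// => j; rewrite (ord1 j) (ord1 i).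
by apply: le_trans (vs i); rewrite lerN2 ler_peMl// ler1n.
Qed.

Lemma discrepancyS (m : nat) (a b : nat -> 'cV[R]_m) (k : nat) :
  discrepancy a b k.+1 = discrepancy a b k + a k.+1 - b k.+1.
Proof. by rewrite /discrepancy big_nat_recr//= addrA. Qed.

Lemma discrepancy_sum0 (m : nat) (a b : nat -> 'cV[R]_m) (k : nat) :
  (forall j, (0 < j)%N -> simplex (a j)) ->
  (forall j, (j < k)%N -> unit_vectors (b j.+1)) ->
  \sum_i discrepancy a b k i 0 = 0.
Proof.
move=> aD bE; elim: k bE => [|k IH] bE.
  by rewrite /discrepancy big_geq// big1// => i _; rewrite mxE.
under eq_bigr do rewrite discrepancyS !mxE.
rewrite big_split sumrN big_split /= IH => [|j jk]; last exact/bE/ltnW.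
have [i _ <-] := bE k (ltnSn k); rewrite sum_delta_mx.
by have [-> _] := aD k.+1 isT; rewrite add0r subrr.
Qed.

(** For positive [k] this is the condition met by the last selection; for [k = 0] the discrepancy is
    zero and [0 <= s] gives the bound. *)
Lemma admissible_discrepancy_ge (m : nat) (s : R) (a b : nat -> 'cV[R]_m) k :
  0 <= s -> (forall j, (j < k)%N -> admissible s a b j (b j.+1)) ->
  forall i, - s <= discrepancy a b k i 0.
Proof.
case: k => [|k] s0 adm i; first by rewrite /discrepancy big_geq// mxE oppr_le0.
by have [_ /(_ i)] := adm k (ltnSn k); rewrite -discrepancyS !mxE mulr1.
Qed.

Lemma admissible_ex (m : nat) (s : R) (a b : nat -> 'cV[R]_m) (k : nat) :
  (forall j, (0 < j)%N -> simplex (a j)) -> 1 <= s ->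
  (forall j, (j < k)%N -> admissible s a b j (b j.+1)) ->
  exists e, admissible s a b k e.
Proof.
move=> aD s1 adm; pose v := discrepancy a b k + a k.+1.
have [a1 a0] := aD k.+1 isT.
have v1 : \sum_i v i 0 = 1.
  under eq_bigr do rewrite mxE.
  by rewrite big_split /= a1 discrepancy_sum0 ?add0r// => j /adm[].
have vs i : - s <= v i 0.
  rewrite mxE -[leLHS]addr0 lerD//; last by have := a0 i; rewrite mxE.
  exact: admissible_discrepancy_ge (le_trans ler01 s1) adm i.
(* Otherwise all entries would be nonpositive, against their sum 1. *)
have [i vi] : exists i, 0 < v i 0.
  apply/existsP; rewrite -[X in is_true X]negbK negb_exists; apply/negP => /forallP v0.
  have : \sum_i v i 0 <= 0 by apply: sumr_le0 => i _; rewrite leNgt.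
  by rewrite v1 ler10.
exists (delta_mx i 0); split=> [|j]; first by exists i.
rewrite -/v; clearbody v; rewrite !mxE mulr1 eqxx andbT.
have [->|_] := eqVneq j i; last by rewrite subr0 vs.
by rewrite lerBrDr (le_trans _ (ltW vi))// addrC subr_le0.
Qed.

End lemmas.

Theorem theorem4 (R : realType) (n : nat) (D : {fset 'cV[R]_n})
    (d : 'I_#|` D| -> 'cV[R]_n) (d_enum : set_bij [set: 'I_#|` D|] [set` D] d)
    (X : 'M[R]_(n, #|` D|)) (X_def : X = mx_of_cols d)
    (z : nat -> 'cV[R]_n) (a : nat -> 'cV[R]_#|` D|)
    (z_hull : forall k, (0 < k)%N -> conv_hull [set` D] (z k))
    (a_simplex : forall k, (0 < k)%N -> simplex (a k))
    (z_def : forall k, (0 < k)%N -> z k = X *m a k)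
    (s : R) :
  (1 <= s ->
   forall (k : nat) (b : nat -> 'cV[R]_#|` D|),
     (forall j, (j < k)%N -> admissible s a b j (b j.+1)) ->
     exists e, admissible s a b k e)
  /\
  (forall (b : nat -> 'cV[R]_#|` D|) (x : nat -> 'cV[R]_n),
     (forall k, admissible s a b k (b k.+1)) ->
     (forall k, (0 < k)%N -> x k = X *m b k) ->
     forall k, (0 < k)%N ->
       x k \in D /\
       `|\sum_(1 <= i < k.+1) (z i - x i)|
         <= (#|` D|%:R - 1) * s * opnorm_inf X).
Proof.
split=> [s1 k b|b x adm x_def k k0]; first exact: admissible_ex.
have bE j : (j < k)%N -> unit_vectors (b j.+1) by case: (adm j).
split.
  (* [b k] is a unit vector, so [x k] is a column of [X], hence a point of [D]. *)
  case: k k0 bE => // k k0 /(_ k (ltnSn k))[i _ bi].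
  have [+ _ _] := d_enum; move=> /(_ i I) /=.
  by rewrite x_def// -bi X_def -colE; congr (_ \in D); apply/colP => j; rewrite !mxE.
have -> : \sum_(1 <= i < k.+1) (z i - x i) = X *m discrepancy a b k.
  rewrite mulmx_sumr; apply: eq_big_nat => i /andP[i0 _].
  by rewrite z_def// x_def// mulmxBr.
rewrite mulrC; apply: le_trans (norm_mulmx_le _ _) _.
rewrite ler_wpM2l ?opnorm_inf_ge0//; apply: norm_sum0_le.
(* The index of any selected unit vector shows that [D] is nonempty. *)
- by case: k k0 bE => // k _ /(_ k (ltnSn k))[i _ _]; apply: leq_ltn_trans (ltn_ord i).
- exact: discrepancy_sum0.
(* The sign of [s] is not known here, so [admissible_discrepancy_ge] does not apply; as [k] is
   positive, its last selection gives the bound directly. *)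
- move=> i; case: k k0 {bE} => // k _.
  by have [_ /(_ i)] := adm k; rewrite -discrepancyS !mxE mulr1.
Qed.
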